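(* Let $\Lambda\colon\mathbb{R}\to[0,1]$ be locally right monotone, and assume that $Q_\Lambda^+(F)\in\mathbb{R}$ for all $F\in\mathcal M$. Let $$\mathcal D:=\{x\in\mathbb{R}\mid\text{there exists }y>x\text{ such that }\Lambda\text{ is decreasing on }(x,y)\}.$$ The following are equivalent: (a) $Q_\Lambda^+$ has the CxLS property. (b) For all $x\in\mathbb{R}\setminus\mathcal D$, it holds that $\Lambda(x)<\Lambda(x+)$.
   Context: $\mathcal M$ is the set of cumulative distribution functions on $\mathbb{R}$. For $F\in\mathcal M$, $Q_\Lambda^+(F):=\inf\{x\in\mathbb{R}\mid F(x)>\Lambda(x)\}$, with $\inf\varnothing=\infty$. ''Increasing'' and ''decreasing'' are in the weak sense. $\Lambda$ is locally right monotone if for all $x\in\mathbb{R}$ there exists $y>x$ such that $\Lambda|_{(x,y)}$ is monotone; in particular the right limit $\Lambda(x+):=\lim_{y\downarrow x}\Lambda(y)$ exists for all $x\in\mathbb R$. A functional $\rho$ on $\mathcal M$ has the CxLS property if for all $F,G\in\mathcal M$, $c\in\mathbb{R}$ and $\lambda\in(0,1)$: $\rho(F)=\rho(G)=c$ implies $\rho(\lambda F+(1-\lambda)G)=c$. *)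

(* Defs.v *)
From HB Require Import structures.
From mathcomp Require Import all_boot all_order all_algebra.
From mathcomp Require Import all_classical all_reals all_analysis.

Set Implicit Arguments.
Unset Strict Implicit.
Unset Printing Implicit Defensive.

Import Order.TTheory GRing.Theory Num.Theory.
Import numFieldNormedType.Exports.

Local Open Scope classical_set_scope.
Local Open Scope ring_scope.

(* Nondecreasing, right-continuous functions with limits 0 at -oo and 1 at
   +oo. *)
Notation cdfType R := (cumulativeBounded (0 : R) (1 : R)).

Definition mixture (R : realType) (l : R) (l01 : 0 < l < 1)
  (F G : cdfType R) : R -> R := fun x => l * F x + (1 - l) * G x.

Section mixture_is_cdf.
Context (R : realType) (l : R) (l01 : 0 < l < 1) (F G : cdfType R).

Let mixture_nondecreasing : nondecreasing (mixture l01 F G).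
Proof.
move=> x y xy; case/andP: l01 => l0 l1; apply: lerD.
  by rewrite ler_wpM2l ?(ltW l0)// (cumulative_is_nondecreasing F).
by rewrite ler_wpM2l ?subr_ge0 ?(ltW l1)// (cumulative_is_nondecreasing G).
Qed.

Let mixture_right_continuous : right_continuous (mixture l01 F G).
Proof.
move=> x; apply: cvgD; apply: cvgM; try exact: cvg_cst;
  exact: cumulative_is_right_continuous.
Qed.

HB.instance Definition _ := isCumulative.Build R _ R (mixture l01 F G)
  mixture_nondecreasing mixture_right_continuous.

Let mixture_cvgNy : mixture l01 F G @ -oo --> (0 : R).
Proof.
rewrite [X in _ --> X](_ : 0 = l * 0 + (1 - l) * 0); last first.
  by rewrite !mulr0 addr0.
by apply: cvgD; apply: cvgM; try exact: cvg_cst; exact: cumulativeNy.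
Qed.

Let mixture_cvgy : mixture l01 F G @ +oo --> (1 : R).
Proof.
rewrite [X in _ --> X](_ : 1 = l * 1 + (1 - l) * 1); last first.
  by rewrite !mulr1 addrC subrK.
by apply: cvgD; apply: cvgM; try exact: cvg_cst; exact: cumulativey.
Qed.

HB.instance Definition _ := isCumulativeBounded.Build R 0 1 (mixture l01 F G)
  mixture_cvgNy mixture_cvgy.

End mixture_is_cdf.

Definition Lambda_quantile (R : realType) (Lambda : R -> R) (F : cdfType R)
  : \bar R := ereal_inf [set x%:E | x in [set x | Lambda x < F x]].

Definition increasing_on (R : realType) (f : R -> R) (x y : R) : Prop :=
  {in `]x, y[ &, nondecreasing_fun f}.

Definition decreasing_on (R : realType) (f : R -> R) (x y : R) : Prop :=
  {in `]x, y[ &, nonincreasing_fun f}.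

Definition locally_right_monotone (R : realType) (f : R -> R) : Prop :=
  forall x, exists2 y, x < y & increasing_on f x y \/ decreasing_on f x y.

Definition right_decreasing_set (R : realType) (f : R -> R) : set R :=
  [set x | exists2 y, x < y & decreasing_on f x y].

(* This is the genuine right limit when f is bounded and locally right
   monotone; [lim] is a default value when there is no limit. *)
Definition right_limit (R : realType) (f : R -> R) (x : R) : R :=
  lim (f z @[z --> x^'+]).

Definition CxLS (R : realType) (rho : cdfType R -> \bar R) : Prop :=
  forall (F G : cdfType R) (c l : R) (l01 : 0 < l < 1),
    rho F = c%:E -> rho G = c%:E -> rho (mixture l01 F G) = c%:E.

(* Main.v *)
(** Let [F] and [G] have quantile [c]. If [Lambda] decreases on [(c, y)], then
  [F] exceeds [Lambda] either at [c] or on all of [(c, y)], and by right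
  continuity [F] and [G] exceed [Lambda] at common points arbitrarily close to
  [c]. If [c] is not in D and [Lambda c < Lambda (c+)], right continuity forces
  both to exceed [Lambda] at [c]. In both cases so does every mixture.

  Conversely, let [c] be outside D with [Lambda (c+) <= Lambda c]. Then
  [Lambda] takes strictly decreasing values along some sequence [z n]
  decreasing to [c]. Two staircase distribution functions carried by [c, +oo)
  which jump slightly above [Lambda] alternately, one at the [z n] with [n]
  even, the other at those with [n] odd, have quantile [c], but their average
  stays below [Lambda] to the left of [z 1]. *)
Require Import Defs.
From HB Require Import structures.
From mathcomp Require Import all_boot all_order all_algebra.
From mathcomp Require Import all_classical all_reals all_analysis.
From mathcomp Require Import lra.

Import Order.TTheory GRing.Theory Num.Theory.
Import numFieldNormedType.Exports.

Local Open Scope classical_set_scope.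
Local Open Scope ring_scope.

Set Implicit Arguments.
Unset Strict Implicit.
Unset Printing Implicit Defensive.

(** * Quantiles and staircase distribution functions *)

Lemma Lambda_quantileP (R : realType) (Lambda : R -> R) (F : cdfType R)
    (c : R) :
  Lambda_quantile Lambda F = c%:E <->
  (forall x, x < c -> F x <= Lambda x) /\
  (forall d, c < d -> exists2 x, c <= x < d & Lambda x < F x).
Proof.
rewrite /Lambda_quantile; set A := (X in ereal_inf X); split=> [Ac|[lec gtc]].
  have cle x : Lambda x < F x -> c <= x.
    move=> LF; rewrite -lee_fin -Ac; apply: ereal_inf_lbound; by exists x.
  split=> [x xc|d cd].
    by rewrite leNgt; apply/negP => /cle; rewrite leNgt xc.
  have : (ereal_inf A < d%:E)%E by rewrite Ac lte_fin.
  move=> /ereal_inf_lt[_ [x /= LF <-]]; rewrite lte_fin => xd.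
  by exists x => //; rewrite cle.
apply/le_anti/andP; split; last first.
  apply: le_ereal_inf_tmp => _ [x /= LF <-]; rewrite lee_fin leNgt.
  by apply/negP => /lec; rewrite leNgt LF.
apply/lee_addgt0Pr => e e0.
have [|x /andP[_ xe] LF] := gtc (c + e); first by rewrite ltrDl.
rewrite (@le_trans _ _ x%:E)//; last by rewrite lee_fin ltW.
by apply: ereal_inf_lbound; exists x.
Qed.

(* The infimum of the step functions equal to [b] to the left of [t] and to [1]
   from [t] on is right-continuous, since each of them is upper
   semicontinuous. *)
Lemma staircase_cdf (R : realType) (S : set (R * R)) (c T : R) :
  S (c, 0) ->
  (forall t b, S (t, b) -> [/\ t <= T, 0 <= b & b <= 1]) ->
  exists F : cdfType R,
    (forall x t b, S (t, b) -> x < t -> F x <= b) /\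
    (forall x v, v <= 1 -> (forall t b, S (t, b) -> x < t -> v <= b) ->
      v <= F x).
Proof.
(* Including [1] caps the infimum and keeps the set nonempty where no step constrains, as from [T]
   on. *)
move=> Sc Sbnd; pose A x := 1 |` [set b | exists2 t, S (t, b) & x < t].
pose f x := inf (A x).
have A0 x : has_lbound (A x).
  by exists 0 => b [/= ->//|[t /Sbnd[]//]].
have f_le x t b : S (t, b) -> x < t -> f x <= b.
  by move=> Stb xt; apply: ge_inf => //; right; exists t.
have f_le1 x : f x <= 1 by apply: ge_inf => //; left.
have f_ge x v : v <= 1 -> (forall t b, S (t, b) -> x < t -> v <= b) -> v <= f x.
  move=> v1 vb; apply: lb_le_inf; first by exists 1; left.
  by move=> b [/= ->//|[t Stb xt]]; exact: (vb t).
have f_nd : nondecreasing f.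
  move=> x y xy; apply: f_ge => // t b Stb yt.
  by apply: f_le Stb _; exact: le_lt_trans yt.
have f_ge0 x : 0 <= f x by apply: f_ge => // t b /Sbnd[].
have f_rc : right_continuous f.
  move=> x; apply/cvgrPdist_lt => e e0.
  suff [d xd fd] : exists2 d, x < d & forall z, x < z < d -> f z < f x + e.
    near=> z; have xz : x < z by near: z; exact: nbhs_right_gt.
    rewrite distrC ger0_norm ?subr_ge0 ?f_nd ?(ltW xz)// ltrBlDl.
    by apply: fd; rewrite xz/=; near: z; exact: nbhs_right_lt.
  have : f x < f x + e by rewrite ltrDl.
  move=> /inf_lt[|b [/= ->|[t Stb xt]] fe]; first by exists 1; left.
    exists (x + 1); first by rewrite ltrDl.
    by move=> z _; exact: le_lt_trans (f_le1 z) fe.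
  by exists t => // z /andP[_ zt]; exact: le_lt_trans (f_le z t b Stb zt) fe.
have f_Ny : f @ -oo --> (0 : R).
  apply: cvg_near_cst; near=> x; apply/eqP; rewrite eq_le f_ge0 andbT.
  by apply: f_le Sc _; near: x; apply: nbhs_ninfty_lt; exact: num_real.
have f_y : f @ +oo --> (1 : R).
  apply: cvg_near_cst; near=> x; apply/eqP; rewrite eq_le f_le1/=.
  apply: f_ge => // t b /Sbnd[tT _ _] xt.
  suff : T < x by rewrite ltNge (le_trans (ltW xt) tT).
  by near: x; apply: nbhs_pinfty_gt; exact: num_real.
pose F : cdfType R := HB.pack f (isCumulative.Build R _ R f f_nd f_rc)
  (isCumulativeBounded.Build R 0 1 f f_Ny f_y).
by exists F.
Unshelve. all: by end_near. Qed.

(** * Mixtures with a common quantile at points of D *)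

Lemma mixture_le (R : realType) (F G : cdfType R) (l x a : R)
    (l01 : 0 < l < 1) :
  F x <= a -> G x <= a -> mixture l01 F G x <= a.
Proof.
by rewrite /mixture => Fa Ga; case/andP: l01 => l0 l1; nra.
Qed.

Lemma mixture_gt (R : realType) (F G : cdfType R) (l x a : R)
    (l01 : 0 < l < 1) :
  a < F x -> a < G x -> a < mixture l01 F G x.
Proof.
by rewrite /mixture => Fa Ga; case/andP: l01 => l0 l1; nra.
Qed.

Lemma Lambda_quantile_mixture (R : realType) (Lambda : R -> R)
    (F G : cdfType R) (c l : R) (l01 : 0 < l < 1) :
  Lambda_quantile Lambda F = c%:E -> Lambda_quantile Lambda G = c%:E ->
  (forall d, c < d ->
    exists x, [/\ c <= x < d, Lambda x < F x & Lambda x < G x]) ->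
  Lambda_quantile Lambda (mixture l01 F G) = c%:E.
Proof.
move=> /Lambda_quantileP[Fle _] /Lambda_quantileP[Gle _] FG.
apply/Lambda_quantileP; split=> [x xc|d /FG[x [xd LF LG]]].
  by apply: mixture_le; [exact: Fle | exact: Gle].
by exists x => //; exact: mixture_gt.
Qed.

(** Exceedance points near [c] lie strictly to its right, [c] itself being none; from there up to
    [y], [F] grows and [Lambda] decreases, so the excess persists. *)
Lemma Lambda_quantile_right_gt (R : realType) (Lambda : R -> R) (F : cdfType R)
    (c y : R) : decreasing_on Lambda c y ->
  Lambda_quantile Lambda F = c%:E -> F c <= Lambda c ->
  forall x, c < x < y -> Lambda x < F x.
Proof.
move=> decL /Lambda_quantileP[_ Fgt] Fc x /andP[cx xy].
have [x' /andP[cx' x'x] LF] := Fgt x cx.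
have {}cx' : c < x'.
  by rewrite lt_neqAle cx' andbT; apply: contraTneq LF => <-; rewrite -leNgt.
have Fx'x : F x' <= F x by exact/cumulative_is_nondecreasing/ltW.
apply: le_lt_trans (lt_le_trans LF Fx'x).
by apply: decL (ltW x'x); rewrite in_itv/= ?cx ?cx' // (lt_trans x'x).
Qed.

(** If also [F c <= Lambda c], both exceed on all of [(c, y)]. Otherwise [G] stays below [F c] just
    right of [c], so that [Lambda x < G x < F c <= F x]. *)
Lemma Lambda_quantile_common_gt (R : realType) (Lambda : R -> R)
    (F G : cdfType R) (c d : R) : right_decreasing_set Lambda c ->
  Lambda_quantile Lambda F = c%:E -> Lambda_quantile Lambda G = c%:E ->
  G c <= Lambda c -> c < d ->
  exists x, [/\ c <= x < d, Lambda x < F x & Lambda x < G x].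
Proof.
move=> [y cy decL] QF QG GLc cd.
have Ggt := Lambda_quantile_right_gt decL QG GLc.
have [FLc|LFc] := leP (F c) (Lambda c).
  have Fgt := Lambda_quantile_right_gt decL QF FLc.
  near c^'+ => x; have cx : c < x by near: x; exact: nbhs_right_gt.
  have cxy : c < x < y by rewrite cx/=; near: x; exact: nbhs_right_lt.
  exists x; split; [|exact: Fgt|exact: Ggt].
  by rewrite ltW//=; near: x; exact: nbhs_right_lt.
near c^'+ => x; have cx : c < x by near: x; exact: nbhs_right_gt.
have LGx : Lambda x < G x.
  by apply: Ggt; rewrite cx/=; near: x; exact: nbhs_right_lt.
exists x; split => //.
  by rewrite ltW//=; near: x; exact: nbhs_right_lt.
have Fcx : F c <= F x by exact/cumulative_is_nondecreasing/ltW.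
apply: lt_trans LGx (lt_le_trans _ Fcx).
near: x; apply: (cvgr_lt (G c)); last exact: le_lt_trans LFc.
exact: cumulative_is_right_continuous.
Unshelve. all: by end_near. Qed.

Lemma right_decreasing_mixture (R : realType) (Lambda : R -> R)
    (F G : cdfType R) (c l : R) (l01 : 0 < l < 1) :
  right_decreasing_set Lambda c ->
  Lambda_quantile Lambda F = c%:E -> Lambda_quantile Lambda G = c%:E ->
  Lambda_quantile Lambda (mixture l01 F G) = c%:E.
Proof.
move=> Dc QF QG; apply: Lambda_quantile_mixture => // d cd.
(* If either function fails to exceed [Lambda] at [c], there are common points; if both exceed
   there, [c] serves. *)
have [Gc|LGc] := leP (G c) (Lambda c).
  exact: Lambda_quantile_common_gt Dc QF QG Gc cd.
have [Fc|LFc] := leP (F c) (Lambda c).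
  have [x []] := Lambda_quantile_common_gt Dc QG QF Fc cd.
  by exists x; split.
by exists c; rewrite lexx cd.
Qed.

(** * Right limits and upward jumps of [Lambda] *)

Lemma increasing_on_cvg_right_limit (R : realType) (f : R -> R) (c y m : R) :
  c < y -> increasing_on f c y -> (forall x, m <= f x) ->
  f z @[z --> c^'+] --> right_limit f c.
Proof.
move=> cy incf fm.
have flim : f z @[z --> c^'+] --> inf (f @` [set` `]c, y[]).
  apply: (@nondecreasing_at_right_cvgr _ f c (BLeft y)) => //.
  by exists m => _ [x _ <-].
by rewrite /right_limit (cvg_lim _ flim).
Qed.

(** Otherwise, just right of [c], [F] stays below and [Lambda] above the midpoint of [Lambda c] and
    [r], leaving no exceedance point near [c]. *)
Lemma Lambda_quantile_atom (R : realType) (Lambda : R -> R) (F : cdfType R)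
    (c r : R) : Lambda z @[z --> c^'+] --> r -> Lambda c < r ->
  Lambda_quantile Lambda F = c%:E -> Lambda c < F c.
Proof.
move=> Lr Lcr /Lambda_quantileP[_ Fgt]; rewrite ltNge; apply/negP => FcL.
have [FcM Mr] := midf_lt Lcr; set m := _ / 2 in FcM Mr.
have : \forall z \near c^'+, F z < Lambda z.
  near=> z; apply: (@lt_trans _ _ m); near: z.
    apply: (cvgr_lt (F c)); last exact: le_lt_trans FcM.
    exact: cumulative_is_right_continuous.
  exact: (cvgr_gt r).
move=> [e /= e0 FltL].
have [|x /andP[cx xe] LF] := Fgt (c + e); first by rewrite ltrDl.
move: cx; rewrite le_eqVlt => /predU1P[cx|cx].
  by move: LF; rewrite -cx ltNge FcL.
have : F x < Lambda x by apply: FltL => //=; rewrite distrC gtr0_norm ?subr_gt0// ltrBlDl.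
by rewrite ltNge (ltW LF).
Unshelve. all: by end_near. Qed.

(** * Failure of CxLS outside D *)

(** Otherwise [f >= f x] on some [(c, e)] with [e <= x]; as [f] increases, it is constant there,
    hence decreasing, which puts [c] in D. *)
Lemma increasing_on_strict (R : realType) (f : R -> R) (c y x d : R) :
  increasing_on f c y -> ~ right_decreasing_set f c ->
  c < x < y -> c < d -> exists x', [/\ c < x', x' < x, x' < d & f x' < f x].
Proof.
move=> incf nDc /andP[cx xy] cd; pose e := Num.min x d.
have ce : c < e by rewrite lt_min cx.
apply: contrapT => /forallNP nx; apply: nDc; exists e => // u v.
have ge_fx w : w \in `]c, e[ -> f x <= f w.
  rewrite in_itv/= lt_min => /and3P[cw wx wd].
  by rewrite leNgt; apply/negP => fwx; exact: (nx w).
move=> uI vI uv; apply: le_trans (ge_fx _ uI); apply: incf.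
- by move: vI; rewrite !in_itv/= lt_min => /and3P[-> vx _]/=; exact: lt_trans xy.
- by rewrite in_itv/= cx.
- by move: vI; rewrite in_itv/= lt_min => /and3P[_ /ltW].
Qed.

Lemma increasing_on_seq (R : realType) (f : R -> R) (c y : R) :
  c < y -> increasing_on f c y -> ~ right_decreasing_set f c ->
  exists z : nat -> R, [/\ forall n, c < z n < y, forall n, z n.+1 < z n,
    forall n, f (z n.+1) < f (z n) & forall x, c < x -> exists n, z n < x].
Proof.
move=> cy incf nDc.
(* The pair carries the iteration index, so that step [n] lands within [1/(n+1)] of [c]. Outside
   [(c, y)], which the iteration never leaves, the value is arbitrary. *)
have /choice[g gP] (nx : nat * R) : exists x', c < nx.2 < y ->
    [/\ c < x', x' < nx.2, x' < c + nx.1.+1%:R^-1 & f x' < f nx.2].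
  have [cxy|ncxy] := pselect (c < nx.2 < y); last by exists 0.
  have := @increasing_on_strict _ _ _ _ _ (c + nx.1.+1%:R^-1) incf nDc cxy.
  by rewrite ltrDl invr_gt0 ltr0n => /(_ isT)[x' ?]; exists x'.
pose z n := iteri n (fun k x => g (k, x)) ((c + y) / 2).
have zI n : c < z n < y.
  elim: n => [|n /[dup] /andP[_ zy] /(gP (n, z n))[/= cz zz _ _]].
    by rewrite /z/= !midf_lt.
  by rewrite cz (lt_trans zz).
exists z; split=> // [n|n|x cx].
- by have [] := gP (n, z n) (zI n).
- by have [] := gP (n, z n) (zI n).
- have [k ckx] := ltr_add_invr cx; exists k.+1.
  by have [_ _ zk _] := gP (k, z k) (zI k); exact: lt_trans ckx.
Qed.

(* [F i] jumps at the [z n] with [n] of parity [i], to the level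
   [b n.-1 > L n]; these levels are so close to [L] that
   [b n + b n.+1 <= 2 L n.+1]. *)
Lemma interlaced_cdfs (R : realType) (c : R) (z L : nat -> R) :
  (forall n, c < z n) -> (forall n, z n.+1 < z n) ->
  (forall n, 0 <= L n <= 1) -> (forall n, L n.+1 < L n) ->
  exists F : bool -> cdfType R,
    [/\ forall i x, x < c -> F i x <= 0, forall i n, F i c <= L n,
      forall n, L n.+1 < F (odd n.+1) (z n.+1) &
      forall n x, z n.+2 <= x < z n.+1 ->
        F false x + F true x <= L n.+2 + L n.+2].
Proof.
move=> cz zS L01 LS.
have zdec : {homo z : m n / (m < n)%N >-> n < m}.
  by apply: homo_ltn => // v u w uv vw; exact: lt_trans vw uv.
have zle m n : (m <= n)%N -> z n <= z m.
  by rewrite leq_eqVlt => /predU1P[->//|/zdec/ltW].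
(* Half the gap above gives [b n < L n]. In [b n + b n.+1], the two halves of the gap from [L n.+2]
   to [L n.+1] add up to at most that gap. *)
pose b n := L n.+1 + Num.min (L n - L n.+1) (L n.+1 - L n.+2) / 2.
have bP n : [/\ L n.+1 < b n, b n < L n & b n + b n.+1 <= L n.+1 + L n.+1].
  have := LS n; have := LS n.+1; have := LS n.+2; rewrite /b.
  by split; rewrite /Num.min; repeat case: ifPn => ?; lra.
have bdec m n : (m <= n)%N -> b n <= b m.
  elim: n => [|n IH]; first by rewrite leqn0 => /eqP->.
  rewrite leq_eqVlt => /predU1P[->//|/IH]; apply: le_trans.
  by have [Lb _ _] := bP n; have [_ bL _] := bP n.+1; rewrite ltW// (lt_trans bL).
(* The cap [b n.+1] left of [z n] is the level kept back to [z n.+2], the neighbouring jump of the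
   same parity, and exceeds [L n.+2]. *)
pose S i := (c, 0) |` [set (z n, b n.+1) | n in [set n | odd n = i]].
have b_ge0 n : 0 <= b n.
  by have [Lb _ _] := bP n; rewrite (le_trans _ (ltW Lb))//; case/andP: (L01 n.+1).
have b_le1 n : b n <= 1.
  by have [_ bL _] := bP n; rewrite (le_trans (ltW bL))//; case/andP: (L01 n).
have /choice[F FP] i : exists F : cdfType R,
    (forall x t b', S i (t, b') -> x < t -> F x <= b') /\
    (forall x v, v <= 1 -> (forall t b', S i (t, b') -> x < t -> v <= b') ->
      v <= F x).
  apply: (@staircase_cdf _ _ c (z 0)) => [|t b' [[-> ->]|[n _ [<- <-]]]].
  - by left.
  - by split => //; exact: ltW.
  - by split => //; exact: zle.
have F_le n x : x < z n -> F (odd n) x <= b n.+1.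
  by move=> xz; apply: (FP _).1 xz; right; exists n.
have F_ge n : b n <= F (odd n.+1) (z n.+1).
  apply: (FP _).2 => // t b' [[-> _]|[m /= mn [<- <-]]] ltz.
    by move: ltz; rewrite ltNge ltW.
  (* A cap active at [z n.+1] has index [m <= n], and parity excludes [m = n]. *)
  apply: bdec; rewrite ltnNge; apply/negP => nm.
  have : (m <= n)%N.
    by rewrite -ltnS ltnNge; apply/negP => /zle; rewrite leNgt ltz.
  by rewrite leq_eqVlt ltnNge nm orbF => /eqP mE; move: mn; rewrite mE /=; case: odd.
exists F; split=> [i x xc|i n|n|n x /andP[zx xz]].
- by apply: (FP i).1 xc; left.
- have [k [nk ki]] : exists k, (n <= k)%N /\ odd k = i.
    have [ni|ni] := eqVneq (odd n) i; first by exists n.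
    by exists n.+1; split=> //=; case: (odd n) i ni => -[].
  have Fk := F_le k c (cz k); rewrite -ki (le_trans Fk)//.
  have [_ bL _] := bP n.
  by apply: ltW; apply: le_lt_trans bL; apply: bdec; exact: leqW.
- by have [Lb _ _] := bP n; exact: lt_le_trans (F_ge n).
- have [_ _ bb] := bP n.+1.
  have := F_le n.+1 x xz; have := F_le n x (lt_trans xz (zS n)).
  by rewrite /=; case: (odd n) => /=; lra.
Qed.

Lemma CxLS_lt_right_limit (R : realType) (Lambda : R -> R) (c : R) :
  (forall x, 0 <= Lambda x <= 1) -> locally_right_monotone Lambda ->
  CxLS (Lambda_quantile Lambda) -> ~ right_decreasing_set Lambda c ->
  Lambda c < right_limit Lambda c.
Proof.
move=> L01 lrm cx nDc; rewrite ltNge; apply/negP => rLc.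
have [y cy [incL|decL]] := lrm c; last by apply: nDc; exists y.
have Lr : Lambda z @[z --> c^'+] --> right_limit Lambda c.
  by apply: (increasing_on_cvg_right_limit cy incL (m := 0)) => x; case/andP: (L01 x).
have [z [zI zS LzS zc]] := increasing_on_seq cy incL nDc.
have cz n : c < z n by case/andP: (zI n).
have [F [F0 Fc Fgt Fle]] :=
  interlaced_cdfs cz zS (fun n => L01 (z n)) LzS.
have zle m n : (m <= n)%N -> z n <= z m.
  elim: n => [|n IH]; first by rewrite leqn0 => /eqP->.
  by rewrite leq_eqVlt => /predU1P[->//|/IH]; apply: le_trans; exact: ltW.
have Lle u x : c < u -> u <= x -> x < y -> Lambda u <= Lambda x.
  move=> cu ux xy; apply: incL => //.
    by rewrite in_itv/= cu (le_lt_trans ux).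
  by rewrite in_itv/= xy (lt_le_trans cu).
(* [F i c] lies below every [Lambda (z n)], hence below the right limit, which is at most [Lambda c]
   by assumption. *)
have FcL i : F i c <= Lambda c.
  apply: le_trans rLc; apply: limr_ge; first by apply/cvg_ex; eexists; exact: Lr.
  near=> x; have cx' : c < x by near: x; exact: nbhs_right_gt.
  have [n zx] := zc x cx'; apply: le_trans (Fc i n) _.
  apply: Lle (cz n) (ltW zx) _; near: x; exact: nbhs_right_lt.
have QF i : Lambda_quantile Lambda (F i) = c%:E.
  apply/Lambda_quantileP; split=> [x xc|d cd].
    by apply: le_trans (F0 i x xc) _; case/andP: (L01 x).
  have [n zd] := zc d cd.
  have [k nk ki] : exists2 k, (n <= k.+1)%N & odd k.+1 = i.
    have [ni|ni] := eqVneq (odd n.+1) i; first by exists n.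
    exists n.+1; first exact/leqW/leqnSn.
    by move: ni => /=; case: (odd n) i => -[].
  exists (z k.+1); last by rewrite -ki.
  by rewrite ltW//= (le_lt_trans (zle _ _ nk)).
have h01 : 0 < (2^-1 : R) < 1 by lra.
have /Lambda_quantileP[_ /(_ (z 1) (cz 1))] := cx _ _ _ _ h01 (QF false) (QF true).
move=> [x /andP[]]; rewrite le_eqVlt => /predU1P[<- _|cx' xz].
  by rewrite ltNge mixture_le.
apply/negP; rewrite -leNgt.
(* The least index with [z n <= x] is at least 2 because [x < z 1]; this places [x] in a cell where
   the interlacing bound applies. *)
have ex : exists n, z n <= x by have [n /ltW] := zc x cx'; exists n.
case: (ex_minnP ex) => -[|[|n]] zx zmin.
- by move: xz; rewrite ltNge (le_trans _ zx)// zle.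
- by move: xz; rewrite ltNge zx.
have xzn : x < z n.+1.
  by rewrite ltNge; apply/negP => /zmin; rewrite ltnn.
have := Fle n x; rewrite zx xzn => /(_ isT).
have xy : x < y by apply: lt_trans xz _; case/andP: (zI 1).
have := Lle _ _ (cz n.+2) zx xy.
move=> LzL FF.
change (2^-1 * F false x + (1 - 2^-1) * F true x <= Lambda x); lra.
Unshelve. all: by end_near. Qed.

Unset Implicit Arguments.

Theorem proposition6p5 (R : realType) (Lambda : R -> R)
    (Lambda01 : forall x, 0 <= Lambda x <= 1)
    (Lambda_lrm : locally_right_monotone Lambda)
    (Q_fin : forall F : cdfType R, Lambda_quantile Lambda F \is a fin_num) :
  CxLS (Lambda_quantile Lambda) <->
  (forall x, (~` right_decreasing_set Lambda) x ->
    Lambda x < right_limit Lambda x).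
Proof.
split=> [cx c nDc|LL F G c l l01 QF QG]; first exact: CxLS_lt_right_limit.
have [Dc|nDc] := pselect (right_decreasing_set Lambda c).
  exact: right_decreasing_mixture.
(* Outside D, local monotonicity can only mean increasing, so the right limit exists and [c] itself
   is a common exceedance point. *)
have [y cy [incL|decL]] := Lambda_lrm c; last by case: nDc; exists y.
have Lr : Lambda z @[z --> c^'+] --> right_limit Lambda c.
  by apply: (increasing_on_cvg_right_limit cy incL (m := 0)) => x;
    case/andP: (Lambda01 x).
have atom H := @Lambda_quantile_atom _ _ H _ _ Lr (LL _ nDc).
apply: Lambda_quantile_mixture => // d cd; exists c.
by rewrite lexx cd; split; [|exact: atom|exact: atom].
Qed.
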